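(* Let $a,k$ be integers with $a\ge2$, $k\ge3$ and $k$ odd. The subtraction game $\mathcal{S}(a,ka+1,(k+6)a+1)$ is periodic with period $2ka+6a+2$ and nim-sequence $\big((0^a1^a)^{(k+1)/2}2\big)^2\big(0^{a-1}3\,1^{a-1}2\big)^2$. Moreover, the subtraction set has expansion $\{a,\,ka+1,\,(k+2)a+1,\,(k+4)a+1,\,(k+6)a+1,\,(2k+5)a+2\}^{*(2ka+6a+2)}$.
   Context: For a finite set $S$ of positive integers, the subtraction game $\mathcal{S}(S)$ is played on a single pile: two players alternately remove $s\in S$ coins (at most the pile size); the last mover wins. The nim-value is $\mathcal{G}(n)=\operatorname{mex}\{\mathcal{G}(n-s): s\in S, s\le n\}$. Words of single digits are written by juxtaposition, and $x^m$ denotes $m$-fold repetition of the block $x$ ($x^0$ empty). ''The game is periodic with period $p$ and nim-sequence $W$'' ($W$ a word of length $p$) means $\mathcal{G}(n+p)=\mathcal{G}(n)$ for all $n\ge0$, $p$ is the least such, and $\mathcal{G}(n)$ is the $((n\bmod p)+1)$-st letter of $W$ for all $n\ge0$. The expansion of $S$ is $S^{ex}=\{s\ge1:\mathcal{G}(n+s)\ne\mathcal{G}(n)\ \forall n\ge0\}$; ''has expansion $T$'' means $S^{ex}=T$. For a set $X$ and $p\ge1$, $X^{*p}=\{x+mp:x\in X,m\ge0\}$. *)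

(* Defs.v *)
From mathcomp Require Import all_boot.

Set Implicit Arguments.
Unset Strict Implicit.
Unset Printing Implicit Defensive.

(* The least natural number outside s is at most size s, hence the range. *)
Definition mex (s : seq nat) : nat :=
  find (fun i => i \notin s) (iota 0 (size s).+1).

Lemma mex_has s : has (fun i => i \notin s) (iota 0 (size s).+1).
Proof.
apply/negPn/negP => /hasPn sub.
have: size (iota 0 (size s).+1) <= size s.
  by apply: uniq_leq_size (iota_uniq _ _) _ => i /sub /negPn.
by rewrite size_iota ltnn.
Qed.

Lemma mex_notin s : mex s \notin s.
Proof.
have := nth_find 0 (mex_has s).
by rewrite nth_iota // -[X in _ < X](size_iota 0) -has_find mex_has.
Qed.

Lemma mex_min s i : i < mex s -> i \in s.
Proof.
move=> lt_i; have := before_find 0 lt_i; rewrite nth_iota ?add0n.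
  by move/negbFE.
by apply: leq_trans lt_i _; rewrite -[X in _ <= X](size_iota 0) find_size.
Qed.

(* A finite set of positive integers is given by a sequence listing it; the
   order and the repetitions are irrelevant, and 0 is never a legal move.
   nim_table S n lists the nim-values of 0, ..., n - 1. *)
Fixpoint nim_table (S : seq nat) (n : nat) : seq nat :=
  if n is m.+1 then
    let t := nim_table S m in
    rcons t (mex [seq nth 0 t (m - s) | s <- S & 0 < s <= m])
  else [::].

Definition nim_value (S : seq nat) (n : nat) : nat :=
  nth 0 (nim_table S n.+1) n.

Lemma size_nim_table S n : size (nim_table S n) = n.
Proof. by elim: n => //= n IHn; rewrite size_rcons IHn. Qed.

Lemma nth_nim_table S n i : i < n -> nth 0 (nim_table S n) i = nim_value S i.
Proof.
elim: n => // n IHn; rewrite ltnS leq_eqVlt => /predU1P[-> // | lt_in].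
by rewrite /= nth_rcons size_nim_table lt_in IHn.
Qed.

(* The defining recursion G(n) = mex {G(n - s) : s in S, s <= n}. *)
Lemma nim_valueE S n :
  nim_value S n = mex [seq nim_value S (n - s) | s <- S & 0 < s <= n].
Proof.
rewrite {1}/nim_value /= nth_rcons size_nim_table ltnn eqxx.
congr mex; apply/eq_in_map => s; rewrite mem_filter => /andP[/andP[s0 sn] _].
by rewrite nth_nim_table // ltn_subrL s0 (leq_trans s0 sn).
Qed.

Definition is_period (f : nat -> nat) (p : nat) : Prop :=
  0 < p /\ forall n, f (n + p) = f n.

(* Pure periodicity (no preperiod), p being the least period. *)
Definition periodic_with (S : seq nat) (p : nat) (W : seq nat) : Prop :=
  [/\ size W = p,
      is_period (nim_value S) p,
      forall q, is_period (nim_value S) q -> p <= q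
    & forall n, nim_value S n = nth 0 W (n %% p)].

Definition word_pow (x : seq nat) (m : nat) : seq nat := flatten (nseq m x).

Definition expansion (S : seq nat) (s : nat) : Prop :=
  1 <= s /\ forall n, nim_value S (n + s) <> nim_value S n.

(* X^{*p} = {x + m p : x in X, m >= 0}. *)
Definition star (X : seq nat) (p : nat) (s : nat) : Prop :=
  exists x m, x \in X /\ s = x + m * p.

Definition has_expansion (S : seq nat) (T : nat -> Prop) : Prop :=
  forall s, expansion S s <-> T s.

(* Main.v *)
(* Let w(n) be the n-th letter of the periodic word. The nim-values are w as
   soon as w(n + s) <> w(n) for every move s and every u < w(n) is some w(n - s)
   with s <= n, since the mex recursion has a unique solution. Shifts s and p - s
   separate w simultaneously, so with L = (k + 1) a + 1 the shifts that separate
   w reduce to s <= p / 2 = L + 2a, where a, L - a and L + a do, and every other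
   s has an explicit pair of equal letters at distance s. The period is least
   because the 3s only occur at two positions, which are 2a apart. *)

Require Import Defs.
From mathcomp Require Import all_boot.
From mathcomp Require Import zify.

(** * Uniqueness of the solution of the mex recursion *)

Lemma mex_eq (s : seq nat) (v : nat) :
  v \notin s -> (forall u, u < v -> u \in s) -> mex s = v.
Proof.
move=> vNs lt_v; case: (ltngtP (mex s) v) => // [/lt_v | /mex_min].
  by rewrite (negbTE (mex_notin s)).
by rewrite (negbTE vNs).
Qed.

(** By strong induction the options of [n] carry the values of [f]: separation by the moves keeps
    [f n] out of them, and the second hypothesis supplies every smaller value. *)
Lemma nim_value_unique (S : seq nat) (f : nat -> nat) :
  (forall s n, s \in S -> 0 < s /\ f (n + s) <> f n) ->
  (forall n u, u < f n -> exists s r, [/\ s \in S, n = r + s & f r = u]) ->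
  forall n, nim_value S n = f n.
Proof.
move=> f_neq f_mex; elim/ltn_ind => n IHn; rewrite nim_valueE.
have -> : [seq nim_value S (n - s) | s <- S & 0 < s <= n]
        = [seq f (n - s) | s <- S & 0 < s <= n].
  apply/eq_in_map => s; rewrite mem_filter => /andP[/andP[s_gt0 le_sn] _].
  by apply: IHn; lia.
apply: mex_eq => [|u /f_mex[s [r [sS -> <-]]]].
  apply/mapP => -[s]; rewrite mem_filter => /andP[/andP[_ le_sn]] sS eq_f.
  by case: (f_neq s (n - s) sS) => _; rewrite subnK.
apply/mapP; exists s; last by rewrite addnK.
by rewrite mem_filter sS (f_neq s 0 sS).1 leq_addl.
Qed.

(** * The periodic word and the positions of its letters *)

Lemma word_pow1 (x m : nat) : word_pow [:: x] m = nseq m x.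
Proof. by elim: m => //= m; rewrite /word_pow /= => ->. Qed.

Lemma size_word_pow (x : seq nat) (m : nat) :
  size (word_pow x m) = m * size x.
Proof. by elim: m => //= m IHm; rewrite /word_pow /= size_cat IHm mulSn. Qed.

Lemma nth_word_pow_cat (x y : seq nat) (m j i n : nat) :
  j < m -> i < size x -> n = j * size x + i ->
  nth 0 (word_pow x m ++ y) n = nth 0 x i.
Proof.
move=> + lt_ix ->; elim: m j => // m IHm [|j] lt_jm;
  rewrite /word_pow /= -catA nth_cat.
  by rewrite lt_ix.
by rewrite mulSn -addnA ltnNge leq_addr addKn IHm.
Qed.

(* Here and below k = 2 h + 1. *)
Definition period (a h : nat) : nat := 4 * (h * a) + 8 * a + 2.

Definition long_word (a h : nat) : seq nat :=
  word_pow (word_pow [:: 0] a ++ word_pow [:: 1] a) h.+1 ++ [:: 2].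

Definition short_word (a : nat) : seq nat :=
  word_pow [:: 0] (a - 1) ++ [:: 3] ++ word_pow [:: 1] (a - 1) ++ [:: 2].

Definition nim_word (a h : nat) : seq nat :=
  word_pow (long_word a h) 2 ++ word_pow (short_word a) 2.

(** This is the length [(k + 1) a + 1] of [long_word]. In terms of it the moves are [a],
    [long a h - a] and [long a h + 5 * a], and the period is [2 * long a h + 4 * a]. *)
Definition long (a h : nat) : nat := 2 * (h * a) + 2 * a + 1.

Lemma size_long_word a h : size (long_word a h) = long a h.
Proof. by rewrite !(size_cat, size_word_pow) /long /=; nia. Qed.

Lemma size_short_word a : 2 <= a -> size (short_word a) = 2 * a.
Proof. by move=> a_ge2; rewrite !(size_cat, size_word_pow) /=; lia. Qed.

Lemma size_nim_word a h : 2 <= a -> size (nim_word a h) = period a h.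
Proof.
move=> a_ge2; rewrite size_cat !size_word_pow size_long_word.
by rewrite size_short_word // /long /period; lia.
Qed.

Definition value (a h n : nat) : nat := nth 0 (nim_word a h) (n %% period a h).

(* Positions of the letters in the periodic word, with unbounded multiplicity m
   of the period: Alt and Sep lie in the b-th copy of (0^a 1^a)^(h+1) 2, Short
   and End in the c-th block (0^(a-1) 3 or 1^(a-1) 2) of the tail. *)
Inductive letter (a h n : nat) : nat -> Prop :=
| Alt m b i t of b < 2 & i < 2 * h + 2 & t < a
    & n = m * period a h + b * long a h + i * a + t : letter a h n (odd i)
| Sep m b of b < 2
    & n = m * period a h + b * long a h + 2 * (h * a) + 2 * a : letter a h n 2
| Short m c t of c < 4 & t.+1 < a
    & n = m * period a h + 2 * long a h + c * a + t : letter a h n (odd c)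
| End m c of c < 4
    & n.+1 = m * period a h + 2 * long a h + c * a + a :
    letter a h n (3 - odd c).

(** The coordinates come from Euclidean divisions: by the period, then by [long a h] and [a] in the
    two long copies, or by [a] alone in the tail. *)
Lemma letter_exists a h n : 2 <= a -> exists v, letter a h n v.
Proof.
move=> a_ge2; have p_gt0 : 0 < period a h by rewrite /period; lia.
have := divn_eq n (period a h); have := ltn_pmod n p_gt0.
set m := n %/ _; set r := n %% _ => lt_rp n_eq.
have a_gt0 : 0 < a by lia.
have [lt_r2L|le_2Lr] := ltnP r (2 * long a h).
  have L_gt0 : 0 < long a h by rewrite /long; lia.
  have := divn_eq r (long a h); have := ltn_pmod r L_gt0.
  have : r %/ long a h < 2 by rewrite ltn_divLR.
  set b := r %/ _; set x := r %% _ => lt_b2 lt_xL r_eq.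
  have [x_eq|x_neq] := eqVneq x (2 * (h * a) + 2 * a).
    by exists 2; apply: (@Sep _ _ _ m b) => //; lia.
  exists (odd (x %/ a)); apply: (@Alt _ _ _ m b (x %/ a) (x %% a)) => //.
  - by rewrite ltn_divLR //; move: lt_xL x_neq; rewrite /long; lia.
  - by rewrite ltn_pmod.
  - by rewrite n_eq r_eq {1}(divn_eq x a); lia.
have := divn_eq (r - 2 * long a h) a.
have := ltn_pmod (r - 2 * long a h) a_gt0.
have : (r - 2 * long a h) %/ a < 4.
  by rewrite ltn_divLR //; move: lt_rp le_2Lr; rewrite /period /long; lia.
set c := _ %/ _; set t := _ %% _ => lt_c4 lt_ta r_eq.
have [t_eq|t_neq] := eqVneq t.+1 a.
  by exists (3 - odd c); apply: (@End _ _ _ m c) => //; lia.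
by exists (odd c); apply: (@Short _ _ _ m c t); lia.
Qed.

(** This turns lookups in the word into arithmetic: later proofs only exhibit the coordinates of a
    position. *)
Lemma valueE a h n v : 2 <= a -> letter a h n v -> value a h n = v.
Proof.
move=> a_ge2 n_v.
have mod_eq m r : n = m * period a h + r -> r < period a h ->
    value a h n = nth 0 (nim_word a h) r.
  by move=> -> lt_r; rewrite /value modnMDl modn_small.
have szL := size_long_word a h; have szS := size_short_word a a_ge2.
have sz2 : size (word_pow [:: 0] a ++ word_pow [:: 1] a) = 2 * a.
  by rewrite size_cat !size_word_pow /=; lia.
have longE b r : b < 2 -> r < long a h ->
    nth 0 (nim_word a h) (b * long a h + r) = nth 0 (long_word a h) r.
  move=> lt_b2 lt_rL; apply: (@nth_word_pow_cat _ _ _ b) => //; rewrite szL //.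
have shortE c r : c < 2 -> r < 2 * a ->
    nth 0 (nim_word a h) (2 * long a h + c * (2 * a) + r)
  = nth 0 (short_word a) r.
  move=> lt_c2 lt_r; rewrite /nim_word nth_cat size_word_pow szL -addnA.
  rewrite ltnNge leq_addr addKn -[word_pow (short_word a) 2]cats0.
  by apply: (@nth_word_pow_cat _ _ _ c) => //; rewrite szS.
case: n_v => [m b i t lt_b2 lt_i lt_ta|m b lt_b2|m c t lt_c4 lt_ta|m c lt_c4] eq_n.
- have lt_it : i * a + t < 2 * (h * a) + 2 * a by nia.
  rewrite (mod_eq m (b * long a h + (i * a + t))); first last.
  + by move: lt_it lt_b2; rewrite /long /period; nia.
  + by lia.
  rewrite longE //; last by rewrite /long; lia.
  (* Run [i] is one half of the pair [0^a 1^a] with index [i./2], and [odd i] selects the half. *)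
  rewrite (@nth_word_pow_cat _ _ _ i./2 (odd i * a + t)) ?sz2; first last.
  + by rewrite -{1}(odd_double_half i) -muln2; lia.
  + by case: (odd i); lia.
  + by lia.
  rewrite nth_cat !word_pow1 size_nseq !nth_nseq.
  by case: (odd i); repeat case: ifP; lia.
- rewrite (mod_eq m (b * long a h + (2 * (h * a) + 2 * a))); first last.
  + by move: lt_b2; rewrite /long /period; nia.
  + by lia.
  rewrite longE //; last by rewrite /long; lia.
  rewrite /long_word nth_cat size_word_pow sz2.
  have -> : h.+1 * (2 * a) = 2 * (h * a) + 2 * a by lia.
  by rewrite ltnn subnn.
- have c_eq := odd_double_half c; rewrite -muln2 in c_eq.
  rewrite (mod_eq m (2 * long a h + c./2 * (2 * a) + (odd c * a + t))); first last.
  + by rewrite /long /period; nia.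
  + by rewrite eq_n -{1}c_eq; lia.
  rewrite shortE; [|lia|case: (odd c); lia].
  rewrite /short_word !word_pow1 nth_cat size_nseq.
  rewrite !nth_nseq; case: (odd c); rewrite ?mul1n ?mul0n ?add0n.
  + case: ifP => [|_]; first lia.
    (* After the [a - 1] zeros, index 0 holds the letter 3, so the ones start at index 1. *)
    have -> : a + t - (a - 1) = t.+1 by lia.
    by rewrite /= nth_cat size_nseq nth_nseq; repeat case: ifP; lia.
  + by repeat case: ifP; lia.
- have c_eq := odd_double_half c; rewrite -muln2 in c_eq.
  rewrite (mod_eq m (2 * long a h + c./2 * (2 * a) + (odd c * a + (a - 1)))); first last.
  + by rewrite /long /period; nia.
  + by move: eq_n; rewrite -{1}c_eq; lia.
  rewrite shortE; [|lia|case: (odd c); lia].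
  rewrite /short_word !word_pow1 nth_cat size_nseq.
  case: (odd c); rewrite ?mul1n ?mul0n ?add0n.
  + case: ifP => [|_]; first lia.
    have -> : a + (a - 1) - (a - 1) = (a - 1).+1 by lia.
    by rewrite /= nth_cat size_nseq ltnn subnn.
  + by rewrite ltnn subnn.
Qed.

Ltac positions := unfold period, long in *; lia.

(** * Shifts that separate the word *)

(** Such a shift moves to the next run, of opposite parity. At the end of a long copy the separator
    costs one position: the first 1 of the last run meets the 2, and the other ones meet zeros. In
    the tail, 3 and 2 alternate. *)
Lemma value_add_a_neq a h n : 2 <= a -> value a h (n + a) <> value a h n.
Proof.
move=> a_ge2; have [v n_v] := letter_exists a h n a_ge2.
rewrite (valueE _ _ _ _ a_ge2 n_v).
have to w : letter a h (n + a) w -> w <> v -> value a h (n + a) <> v.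
  by move=> /(valueE _ _ _ _ a_ge2) ->.
case: n_v to => [m b i t lt_b2 lt_i lt_ta|m b lt_b2|m c t lt_c4 lt_ta|m c lt_c4] eq_n to.
- have [lt_i1|ge_i] := ltnP i.+1 (2 * h + 2).
    by apply: (to _ (@Alt _ _ _ m b i.+1 t _ _ _ _)); positions.
  have i_eq : i = 2 * h + 1 by lia.
  subst i; case: t => [|t] in lt_ta eq_n *.
    by apply: (to _ (@Sep _ _ _ m b _ _)); positions.
  case: b => [|[|//]] in lt_b2 eq_n *.
    by apply: (to _ (@Alt _ _ _ m 1 0 t _ _ _ _)); positions.
  by apply: (to _ (@Short _ _ _ m 0 t _ _ _)); positions.
- case: b => [|[|//]] in lt_b2 eq_n *.
    by apply: (to _ (@Alt _ _ _ m 1 0 (a - 1) _ _ _ _)); positions.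
  by apply: (to _ (@End _ _ _ m 0 _ _)); positions.
- have [lt_c3|c_eq] : c < 3 \/ c = 3 by lia.
    by apply: (to _ (@Short _ _ _ m c.+1 t _ _ _)); positions.
  by subst c; apply: (to _ (@Alt _ _ _ m.+1 0 0 t _ _ _ _)); positions.
- have [lt_c3|c_eq] : c < 3 \/ c = 3 by lia.
    by apply: (to _ (@End _ _ _ m c.+1 _ _)); positions.
  by subst c; apply: (to _ (@Alt _ _ _ m.+1 0 0 (a - 1) _ _ _ _)); positions.
Qed.

(** A run moves to the preceding run of the next long copy, hence changes parity. From the second
    copy it lands in the tail or, since the tail has the length of four runs, in the next period
    with the run index lowered by 4, which keeps parity. *)
Lemma value_add_longB_neq a h n :
  2 <= a -> 1 <= h -> value a h (n + (long a h - a)) <> value a h n.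
Proof.
move=> a_ge2 h_ge1; have [v n_v] := letter_exists a h n a_ge2.
rewrite (valueE _ _ _ _ a_ge2 n_v).
have to w : letter a h (n + (long a h - a)) w -> w <> v ->
    value a h (n + (long a h - a)) <> v.
  by move=> /(valueE _ _ _ _ a_ge2) ->.
have ha_ge : a <= h * a by nia.
case: n_v to => [m b i t lt_b2 lt_i lt_ta|m b lt_b2|m c t lt_c4 lt_ta|m c lt_c4] eq_n to.
- case: i => [|i] in lt_i eq_n to *.
    have [t_eq|t_neq] := eqVneq t.+1 a.
      by apply: (to _ (@Sep _ _ _ m b _ _)); positions.
    by apply: (to _ (@Alt _ _ _ m b (2 * h + 1) t.+1 _ _ _ _)); positions.
  case: b => [|[|//]] in lt_b2 eq_n *.
    by apply: (to _ (@Alt _ _ _ m 1 i t _ _ _ _)); positions.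
  have [lt_i4|ge_i4] := ltnP i 4.
    have [t_eq|t_neq] := eqVneq t.+1 a.
      by apply: (to _ (@End _ _ _ m i _ _)); positions.
    by apply: (to _ (@Short _ _ _ m i t _ _ _)); positions.
  have [j i_eq] : exists j, i = j + 4 by exists (i - 4); lia.
  by subst i; apply: (to _ (@Alt _ _ _ m.+1 0 j t _ _ _ _)); positions.
- case: b => [|[|//]] in lt_b2 eq_n *.
    by apply: (to _ (@Alt _ _ _ m 1 (2 * h + 1) 0 _ _ _ _)); positions.
  have [h_eq|h_ge2] : h = 1 \/ 2 <= h by lia.
    by subst h; apply: (to _ (@Short _ _ _ m 3 0 _ _ _)); positions.
  have [j h_eq] : exists j, h = j + 2 by exists (h - 2); lia.
  by subst h; apply: (to _ (@Alt _ _ _ m.+1 0 (2 * j + 1) 0 _ _ _ _)); positions.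
- have [j h_eq] : exists j, h = j + 1 by exists (h - 1); lia.
  (* The target is run [2 * j + c - 1] of the next period, one place further right. If this index is
     negative, the target is still in the last tail block. *)
  subst h; have [[j_eq c_eq]|jc_gt0] : j = 0 /\ c = 0 \/ 0 < 2 * j + c by lia.
    subst j c; have [t_eq|t_neq] := eqVneq t.+2 a.
      by apply: (to _ (@End _ _ _ m 3 _ _)); positions.
    by apply: (to _ (@Short _ _ _ m 3 t.+1 _ _ _)); positions.
  have [i i_eq] : exists i, 2 * j + c = i.+1 by exists (2 * j + c).-1; lia.
  have ia_eq : 2 * (j * a) + c * a = i * a + a by nia.
  by apply: (to _ (@Alt _ _ _ m.+1 0 i t.+1 _ _ _ _)); positions.
- have [j h_eq] : exists j, h = j + 1 by exists (h - 1); lia.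
  subst h.
  by apply: (to _ (@Alt _ _ _ m.+1 0 (2 * j + c) 0 _ _ _ _)); positions.
Qed.

(** A run now moves to the following run of the next long copy. From the second copy it lands in
    tail block [i + 1], or in run [i - 3] of the next period. *)
Lemma value_add_longD_neq a h n :
  2 <= a -> 1 <= h -> value a h (n + (long a h + a)) <> value a h n.
Proof.
move=> a_ge2 h_ge1; have [v n_v] := letter_exists a h n a_ge2.
rewrite (valueE _ _ _ _ a_ge2 n_v).
have to w : letter a h (n + (long a h + a)) w -> w <> v ->
    value a h (n + (long a h + a)) <> v.
  by move=> /(valueE _ _ _ _ a_ge2) ->.
case: n_v to => [m b i t lt_b2 lt_i lt_ta|m b lt_b2|m c t lt_c4 lt_ta|m c lt_c4] eq_n to.
- case: b => [|[|//]] in lt_b2 eq_n *.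
    have [lt_i1|ge_i] := ltnP i.+1 (2 * h + 2).
      by apply: (to _ (@Alt _ _ _ m 1 i.+1 t _ _ _ _)); positions.
    have i_eq : i = 2 * h + 1 by lia.
    subst i; case: t => [|t] in lt_ta eq_n *.
      by apply: (to _ (@Sep _ _ _ m 1 _ _)); positions.
    by apply: (to _ (@Short _ _ _ m 0 t _ _ _)); positions.
  have [lt_i3|ge_i3] := ltnP i 3.
    have [t_eq|t_neq] := eqVneq t.+1 a.
      by apply: (to _ (@End _ _ _ m i.+1 _ _)); positions.
    by apply: (to _ (@Short _ _ _ m i.+1 t _ _ _)); positions.
  have [j i_eq] : exists j, i = j + 3 by exists (i - 3); lia.
  by subst i; apply: (to _ (@Alt _ _ _ m.+1 0 j t _ _ _ _)); positions.
- case: b => [|[|//]] in lt_b2 eq_n *.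
    by apply: (to _ (@End _ _ _ m 0 _ _)); positions.
  have [j h_eq] : exists j, h = j + 1 by exists (h - 1); lia.
  by subst h; apply: (to _ (@Alt _ _ _ m.+1 0 (2 * j + 1) 0 _ _ _ _)); positions.
- have [lt_c3|c_eq] : c < 3 \/ c = 3 by lia.
    have [j h_eq] : exists j, h = j + 1 by exists (h - 1); lia.
    subst h.
    by apply: (to _ (@Alt _ _ _ m.+1 0 (2 * j + 1 + c) t.+1 _ _ _ _)); positions.
  by subst c; apply: (to _ (@Alt _ _ _ m.+1 1 0 t _ _ _ _)); positions.
- have [lt_c2|[c_eq|c_eq]] : c < 2 \/ c = 2 \/ c = 3 by lia.
  + by apply: (to _ (@Alt _ _ _ m.+1 0 (2 * h + c) 0 _ _ _ _)); positions.
  + by subst c; apply: (to _ (@Sep _ _ _ m.+1 0 _ _)); positions.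
  + by subst c; apply: (to _ (@Alt _ _ _ m.+1 1 0 (a - 1) _ _ _ _)); positions.
Qed.

Lemma value_addMp a h n m : value a h (n + m * period a h) = value a h n.
Proof. by rewrite /value addnC modnMDl. Qed.

(** The shifts [period a h - s] and [s] compose to a full period. *)
Lemma shift_neq_sym a h s :
  s <= period a h -> (forall n, value a h (n + s) <> value a h n) ->
  forall n, value a h (n + (period a h - s)) <> value a h n.
Proof.
move=> le_sp s_neq n eq_n; apply: (s_neq (n + (period a h - s))).
rewrite -addnA subnK // eq_n; have := value_addMp a h n 1; rewrite mul1n; exact.
Qed.

(** * Smaller values are reached by moves *)

(** A letter 1 inside a run reaches 0 by the move [a]. Each 3 reaches 2, 1 and 0 by the moves in
    increasing order; a 2 ending a tail block reaches 0 and 1 by the two larger moves. All targets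
    lie in the same period as [n], so there is no preperiod. *)
Lemma value_mex a h n u :
  2 <= a -> 1 <= h -> u < value a h n ->
  exists s r, [/\ s \in [:: a; long a h - a; long a h + 5 * a], n = r + s
                & value a h r = u].
Proof.
move=> a_ge2 h_ge1; have [v n_v] := letter_exists a h n a_ge2.
rewrite (valueE _ _ _ _ a_ge2 n_v).
have move_by s : s \in [:: a; long a h - a; long a h + 5 * a] ->
    forall r w, letter a h r w -> n = r + s -> w = u ->
    exists s r, [/\ s \in [:: a; long a h - a; long a h + 5 * a], n = r + s
                  & value a h r = u].
  move=> sS r w r_w n_eq <-; exists s, r.
  by rewrite (valueE _ _ _ _ a_ge2 r_w).
have first := move_by a (mem_head _ _).
have second := move_by (long a h - a) ltac:(by rewrite !inE eqxx orbT).
have third := move_by (long a h + 5 * a) ltac:(by rewrite !inE eqxx !orbT).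
have [j h_eq] : exists j, h = j + 1 by exists (h - 1); lia.
case: n_v => [m b i t lt_b2 lt_i lt_ta|m b lt_b2|m c t lt_c4 lt_ta|m c lt_c4] eq_n lt_u.
- case: i => [|i] in lt_i eq_n lt_u *; first by [].
  by apply: (first (n - a) _ (@Alt _ _ _ m b i t _ _ _ _)); positions.
- have [u_eq|u_eq] : u = 1 \/ u = 0 by lia.
    by apply: (first (n - a) _ (@Alt _ _ _ m b (2 * h + 1) 0 _ _ _ _)); positions.
  by apply: (second (n - (long a h - a)) _ (@Alt _ _ _ m b 0 (a - 1) _ _ _ _));
    positions.
- case: c => [|c] in lt_c4 eq_n lt_u *; first by [].
  by apply: (first (n - a) _ (@Short _ _ _ m c t _ _ _)); positions.
- subst h; case: c => [|[|[|[|//]]]] in lt_c4 eq_n lt_u *.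
  + have [u_eq|[u_eq|u_eq]] : u = 2 \/ u = 1 \/ u = 0 by lia.
    * by apply: (first (n - a) _ (@Sep _ _ _ m 1 _ _)); positions.
    * by apply: (second (n - (long a (j + 1) - a)) _
        (@Alt _ _ _ m 1 1 (a - 1) _ _ _ _)); positions.
    * by apply: (third (n - (long a (j + 1) + 5 * a)) _
        (@Alt _ _ _ m 0 (2 * j) 0 _ _ _ _)); positions.
  + have [u_eq|u_eq] : u = 0 \/ u = 1 by lia.
    * by apply: (second (n - (long a (j + 1) - a)) _
        (@Alt _ _ _ m 1 2 (a - 1) _ _ _ _)); positions.
    * by apply: (third (n - (long a (j + 1) + 5 * a)) _
        (@Alt _ _ _ m 0 (2 * j + 1) 0 _ _ _ _)); positions.
  + have [u_eq|[u_eq|u_eq]] : u = 2 \/ u = 1 \/ u = 0 by lia.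
    * by apply: (first (n - a) _ (@End _ _ _ m 1 _ _)); positions.
    * by apply: (second (n - (long a (j + 1) - a)) _
        (@Alt _ _ _ m 1 3 (a - 1) _ _ _ _)); positions.
    * by apply: (third (n - (long a (j + 1) + 5 * a)) _
        (@Alt _ _ _ m 0 (2 * j + 2) 0 _ _ _ _)); positions.
  + have [u_eq|u_eq] : u = 0 \/ u = 1 by lia.
    (* For [j = 0] a long copy has only four runs, so the target lies past the separator, on the
       last zero of the first tail block. *)
    * have [j_eq|j_gt0] := posnP j.
        subst j; by apply: (second (n - (long a (0 + 1) - a)) _
          (@Short _ _ _ m 0 (a - 2) _ _ _)); positions.
      by apply: (second (n - (long a (j + 1) - a)) _
        (@Alt _ _ _ m 1 4 (a - 1) _ _ _ _)); positions.
    * by apply: (third (n - (long a (j + 1) + 5 * a)) _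
        (@Alt _ _ _ m 0 (2 * j + 3) 0 _ _ _ _)); positions.
Qed.

(** * Classification of the separating shifts *)

(** Every other shift joins two equal letters inside the first two long copies. Below
    [long a h - 1], the parity of the quotient of [s] by [a] and the vanishing of the remainder
    decide which pair to take. *)
Lemma small_shift_neq a h s :
  2 <= a -> 1 <= h -> s <= long a h + 2 * a ->
  (forall n, value a h (n + s) <> value a h n) ->
  s \in [:: a; long a h - a; long a h + a].
Proof.
move=> a_ge2 h_ge1 le_s s_neq; rewrite !inE.
apply/negPn/negP; rewrite !negb_or => /and3P[sN1 sN2 sN3].
have same n w : letter a h n w -> letter a h (n + s) w -> False.
  move=> /(valueE _ _ _ _ a_ge2) n_w /(valueE _ _ _ _ a_ge2) ns_w.
  by apply: (s_neq n); rewrite n_w.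
have a_gt0 : 0 < a by lia.
have alt0 t : t < a -> letter a h t 0.
  by move=> lt_t; apply: (@Alt _ _ _ 0 0 0 t); positions.
have ha_ge : a <= h * a by nia.
have [lt_sL|le_Ls] := ltnP s (2 * (h * a) + 2 * a).
  have := divn_eq s a; have := ltn_pmod s a_gt0.
  have : s %/ a < 2 * h + 2 by rewrite ltn_divLR //; lia.
  set q := _ %/ _; set t := _ %% _ => lt_q lt_t s_eq.
  case q_odd: (odd q); last first.
    apply: (same _ _ (alt0 0 a_gt0)); rewrite -[0]/(nat_of_bool false) -q_odd.
    by apply: (@Alt _ _ _ 0 0 q t); positions.
  have [j q_eq] : exists j, q = 2 * j + 1.
    by exists q./2; rewrite -{1}(odd_double_half q) q_odd -muln2; lia.
  clearbody q t; subst q; case: t => [|t] in lt_t s_eq *.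
    (* Crossing the separator 2 from the last block 1^a costs one position, so
       that two 1s are an odd multiple 3a, 5a, ... of a apart. *)
    have [i j_eq] : exists i, j = i + 1.
      by exists (j - 1); case: j s_eq sN1 {lt_q q_odd} => [|j]; lia.
    subst j; apply: (same ((2 * h + 1) * a) 1).
      have -> : 1 = odd (2 * h + 1) by lia.
      by apply: (@Alt _ _ _ 0 0 (2 * h + 1) 0); positions.
    have -> : 1 = odd (2 * i + 1) by lia.
    by apply: (@Alt _ _ _ 0 1 (2 * i + 1) (a - 1)); positions.
  (* From the last 0 of the first run, an odd quotient with positive remainder leads to the next run
     of zeros. For [j = h] this run lies beyond the separator, and remainder 1 is the excluded shift
     [long a h - a]. *)
  apply: (same (a - 1) 0); first by apply: alt0; lia.
  have [j_eq|lt_jh] : j = h \/ j < h by lia.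
    subst j; case: t => [|t] in lt_t s_eq *; first by positions.
    by apply: (@Alt _ _ _ 0 1 0 t); positions.
  have -> : 0 = odd (2 * j + 2) by lia.
  by apply: (@Alt _ _ _ 0 0 (2 * j + 2) t); positions.
have [lt_s|le_s'] := ltnP s (long a h).
  (* Here [s = long a h - 1], which would take position 0 to the separator; position 1 goes to the
     first 0 of the second copy. *)
  apply: (same 1 0); first exact: alt0.
  by apply: (@Alt _ _ _ 0 1 0 0); positions.
have [lt_sa|le_as] := ltnP s (long a h + a).
  apply: (same _ _ (alt0 0 a_gt0)).
  by apply: (@Alt _ _ _ 0 1 0 (s - long a h)); positions.
apply: (same (a - 1) 0); first by apply: alt0; lia.
by apply: (@Alt _ _ _ 0 1 2 (s - long a h - a - 1)); positions.
Qed.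

(** The entries pair up with sum [period a h]: first with last, second with fifth, third with
    fourth. *)
Definition expansion_seq a h : seq nat :=
  [:: a; long a h - a; long a h + a; long a h + 3 * a; long a h + 5 * a;
      period a h - a].

Lemma shift_neqP a h s :
  2 <= a -> 1 <= h -> s <= period a h ->
  reflect (forall n, value a h (n + s) <> value a h n)
          (s \in expansion_seq a h).
Proof.
move=> a_ge2 h_ge1 le_sp.
have p_eq : period a h = 2 * long a h + 4 * a by positions.
have le_aL : a <= long a h by positions.
have fst3 r : r \in [:: a; long a h - a; long a h + a] ->
    forall n, value a h (n + r) <> value a h n.
  rewrite !inE => /or3P[] /eqP-> n.
  - exact: value_add_a_neq.
  - exact: value_add_longB_neq.
  - exact: value_add_longD_neq.
have exE : (s \in expansion_seq a h) =
    (s \in [:: a; long a h - a; long a h + a]) ||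
    (period a h - s \in [:: a; long a h - a; long a h + a]).
  by rewrite !inE; lia.
apply: (iffP idP) => [|s_neq].
  rewrite exE => /orP[/fst3 //|/fst3 ps_neq n].
  by rewrite -[s](subKn le_sp); apply: shift_neq_sym; first exact: leq_subr.
rewrite exE; have [le_s|gt_s] := leqP s (long a h + 2 * a).
  by rewrite small_shift_neq.
rewrite (@small_shift_neq _ _ (period a h - s)) ?orbT //; first by lia.
exact: shift_neq_sym.
Qed.

(** * Minimality of the period *)

Lemma value_least_period a h q :
  2 <= a -> is_period (value a h) q -> period a h <= q.
Proof.
move=> a_ge2 [q_gt0 q_per]; rewrite leqNgt; apply/negP => lt_qp.
(* A period [q] takes the first 3, at [2 * long a h + a - 1], to another 3; being positive and below
   [period a h], it must equal [2 * a]. *)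
have [v n_v] := letter_exists a h (2 * long a h + a - 1 + q) a_ge2.
have v_eq : v = 3.
  rewrite -(valueE _ _ _ _ a_ge2 n_v) q_per.
  by apply: valueE => //; apply: (@End _ _ _ 0 0); positions.
have : q = 2 * a.
  case: n_v v_eq => [m b i t _ _ _|m b _|m c t _ _|m c lt_c4] eq_n v_eq; try lia.
  have m_lt2 : m < 2 by nia.
  by case: c m => [|[|[|[|//]]]] [|[|//]] in lt_c4 m_lt2 v_eq eq_n; positions.
(* The second 3, moved by [2 * a], falls on the last 0 of the first run of the next period. *)
move=> q_eq; have := q_per (2 * long a h + 3 * a - 1).
have -> : 2 * long a h + 3 * a - 1 + q = 2 * long a h + 5 * a - 1 by lia.
rewrite (valueE _ _ _ 0 a_ge2) ?(valueE _ _ _ 3 a_ge2) //.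
  by apply: (@End _ _ _ 0 2); positions.
by apply: (@Alt _ _ _ 1 0 0 (a - 1)); positions.
Qed.

Theorem theorem5p3 (a k : nat) (a_ge2 : 2 <= a) (k_ge3 : 3 <= k)
    (k_odd : odd k) :
  let S := [:: a; k * a + 1; (k + 6) * a + 1] in
  let p := 2 * k * a + 6 * a + 2 in
  let W :=
    word_pow
      (word_pow (word_pow [:: 0] a ++ word_pow [:: 1] a) ((k + 1) %/ 2)
        ++ [:: 2]) 2
    ++ word_pow
      (word_pow [:: 0] (a - 1) ++ [:: 3]
        ++ word_pow [:: 1] (a - 1) ++ [:: 2]) 2 in
  periodic_with S p W /\
  has_expansion S
    (star [:: a; k * a + 1; (k + 2) * a + 1; (k + 4) * a + 1;
              (k + 6) * a + 1; (2 * k + 5) * a + 2] p).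
Proof.
move=> S p W.
have [h k_eq] : exists h, k = 2 * h + 1.
  by exists k./2; rewrite -{1}(odd_double_half k) k_odd -muln2; lia.
have h_ge1 : 1 <= h by lia.
have p_eq : p = period a h by rewrite /p k_eq; positions.
have p_gt0 : 0 < period a h by positions.
have W_eq : W = nim_word a h.
  by rewrite /W; have -> : (k + 1) %/ 2 = h.+1 by lia.
have S_eq : S = [:: a; long a h - a; long a h + 5 * a].
  by rewrite /S k_eq; congr [:: _; _; _]; positions.
have ex_eq : [:: a; k * a + 1; (k + 2) * a + 1; (k + 4) * a + 1;
              (k + 6) * a + 1; (2 * k + 5) * a + 2] = expansion_seq a h.
  by rewrite k_eq /expansion_seq; congr [:: _; _; _; _; _; _]; positions.
have nimE n : nim_value S n = value a h n.
  rewrite S_eq; apply: nim_value_unique n => [s n sS|n u].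
    have le_sp : s <= period a h.
      by move: sS; rewrite !inE => /or3P[] /eqP ->; positions.
    have ha_ge : a <= h * a by nia.
    split; first by move: sS; rewrite !inE => /or3P[] /eqP ->; positions.
    (* The moves are themselves entries of [expansion_seq], so the classification gives their
       separation. *)
    have /(shift_neqP _ _ _ a_ge2 h_ge1 le_sp) : s \in expansion_seq a h; last exact.
    by move: sS; rewrite !inE => /or3P[] ->; rewrite ?orbT.
  exact: value_mex.
rewrite ex_eq p_eq W_eq; split.
  split=> [||q [q_gt0 q_per]|n].
  - exact: size_nim_word.
  - by split=> // n; rewrite !nimE -[period a h]mul1n value_addMp.
  - by apply: value_least_period => //; split=> // n; rewrite -!nimE q_per.
  - exact: nimE.
(* Separation depends only on the residue of the shift, which reduces the expansion to shifts up to
   one period. *)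
have modE s n : value a h (n + s) = value a h (n + s %% period a h).
  by rewrite {1}(divn_eq s (period a h)) [_ * _ + _]addnC addnA value_addMp.
move=> s; split=> [[s_gt0 s_neq]|[x [m [xX s_eq]]]].
  exists (s %% period a h), (s %/ period a h); split; last by rewrite addnC -divn_eq.
  apply/shift_neqP => //; first by rewrite ltnW // ltn_pmod.
  by move=> n; rewrite -modE -!nimE; exact: s_neq.
have ha_ge : a <= h * a by nia.
have [x_gt0 le_xp] : 0 < x /\ x <= period a h.
  move: xX; rewrite !inE.
  by move=> /orP[|/orP[|/orP[|/orP[|/orP[|]]]]] /eqP ->; positions.
split=> [|n]; first by lia.
rewrite !nimE s_eq addnA value_addMp.
by move: n; apply/shift_neqP.
Qed.
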